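(* If $G$ is a graph of order $n$ which is chordal and planar, then $$\psi_3 (G) \le \frac{2}{3}\; n , \qquad \psi_4 (G) \le \frac{4}{7}\; n , \quad \text{and} \quad \psi_5 (G) \le \frac{1}{2}\; n .$$
   Context: Graphs are finite, simple and undirected. The order of $G$ is $n=|V(G)|$. A graph is chordal if it contains no induced cycle on more than three vertices. $P_k$ denotes the path with $k$ vertices. A $k$-path vertex cover of $G$ is a set $T\subseteq V(G)$ such that $G-T$ contains no (not necessarily induced) subgraph isomorphic to $P_k$. $\psi_k(G)$ is the minimum cardinality of a $k$-path vertex cover of $G$. *)

(* Defs.v *)
From mathcomp Require Import all_boot all_order all_algebra.
From mathcomp Require Import all_classical all_reals all_analysis.

Set Implicit Arguments.
Unset Strict Implicit.
Unset Printing Implicit Defensive.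

Import Order.TTheory GRing.Theory Num.Theory.
Import numFieldNormedType.Exports.

Local Open Scope classical_set_scope.
Local Open Scope ring_scope.

Definition simple_graph (V : finType) (e : rel V) : Prop :=
  symmetric e /\ irreflexive e.

(* The vertices listed (cyclically) by c induce exactly the cycle c in e: the
   adjacent pairs are the cyclically consecutive ones, and no others. *)
Definition induced_cycle (V : finType) (e : rel V) (c : seq V) : Prop :=
  [/\ (3 <= size c)%N, uniq c
    & {in c &, forall x y, e x y = (next c x == y) || (next c y == x)}].

Definition chordal (V : finType) (e : rel V) : Prop :=
  forall c : seq V, induced_cycle e c -> ~ (3 < size c)%N.

(* Drawing of e in the plane R^2: vertices are distinct points and every edge
   uv is a simple (Jordan) arc [arc u v], parametrized by [0, 1], joining the
   two ends. [arc u v] and [arc v u] may be parametrized independently but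
   trace the same point set. The interior of an edge contains neither a vertex
   nor an interior point of another edge. The values of [arc] at non-adjacent
   pairs are irrelevant. *)
Record plane_drawing (R : realType) (V : finType) (e : rel V)
    (pos : V -> R * R) (arc : V -> V -> R -> R * R) : Prop := PlaneDrawing {
  pos_inj : injective pos;
  arc_continuous : forall u v, e u v ->
    {within `[0, 1]%classic, continuous (arc u v)};
  arc_inj : forall u v, e u v -> {in `[0, 1] &, injective (arc u v)};
  arc_start : forall u v, e u v -> arc u v 0 = pos u;
  arc_end : forall u v, e u v -> arc u v 1 = pos v;
  arc_sym : forall u v, e u v ->
    arc v u @` `[0, 1]%classic = arc u v @` `[0, 1]%classic;
  arc_avoids_vertices : forall u v w, e u v ->
    {in `]0, 1[, forall t, arc u v t <> pos w};
  arc_disjoint : forall u v x y, e u v -> e x y ->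
    [set u; v]%SET != [set x; y]%SET ->
    {in `]0, 1[ &, forall s t, arc u v s <> arc x y t}
}.

Definition planar (R : realType) (V : finType) (e : rel V) : Prop :=
  exists pos : V -> R * R, exists arc : V -> V -> R -> R * R,
    plane_drawing e pos arc.

(* A not necessarily induced path on k vertices in e is a duplicate-free
   sequence of k vertices whose consecutive members are adjacent. *)
Definition path_vertex_cover (V : finType) (e : rel V) (k : nat)
    (T : {set V}) : bool :=
  ~~ [exists p : k.-tuple V,
       [&& uniq p, sorted e p & all (fun x => x \notin T) p]].

(* For k >= 1 the set of all vertices is a k-path vertex cover, so the minimum
   is attained; the value at k = 0 is meaningless. *)
Definition psi (V : finType) (e : rel V) (k : nat) : nat :=
  #|[arg min_(T < [set: V]%SET | path_vertex_cover e k T) #|T| ]|.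

(* Main.v *)
Require Import Defs.
From mathcomp Require Import all_boot all_order all_algebra.
From mathcomp Require Import all_classical all_reals all_analysis.
From mathcomp Require Import zify lra.
From Stdlib Require Import Btauto.
Import Order.TTheory GRing.Theory Num.Theory.
Import numFieldNormedType.Exports.
Local Open Scope ring_scope.
Set Implicit Arguments.
Unset Strict Implicit.
Unset Printing Implicit Defensive.

(** A chordal graph on n vertices without a clique of more than w vertices has
    psi_{k+1} <= w n / (w + k) for every k >= 1 ([chordal_psi_bound]).  In a
    planar graph cliques have at most 4 vertices ([planar_clique]), and w = 4
    with k = 2, 3, 4 gives the three ratios 4/6, 4/7, 4/8.

    The bound.  Consider the pairs (K, C) where K is a clique, C is a union of
    components of G - K, and C has at least k vertices.  In a pair with C as
    small as possible, C contains no path on k + 1 vertices.  Indeed such a path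
    would lie in one component D of G[C], with more than k vertices; chordality
    yields a vertex d of D adjacent to all the neighbours that D has in K
    ([complete_vertex]), and adding d to these neighbours gives a clique that
    cuts off D - d, a smaller set that still has k vertices
    ([cut_off_smaller]).  Now put K into the cover, keep all of C, and treat the
    remaining vertices in the same way: at most w vertices are spent for at
    least k vertices kept ([path_cover_bound]).

    The cliques.  Suppose that K5 is drawn in the plane.  For two disjoint
    edges, drawn as arcs f and g, the vector f(s) - g(t) never vanishes on the
    unit square, so it has winding number 0 along the boundary of the square.
    Modulo 2, winding is counted by the crossings of a fixed ray.  On the four
    sides of the square this counts the turns of f around the two ends of g, and
    of g around the two ends of f, except that on two of the sides the vector
    points the opposite way, which adds a correction that only depends on the
    positions of the four vertices ([crossings_square]).  Add these equations
    over the 15 pairs of disjoint edges of K5.  The turn of an edge around a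
    vertex v off that edge occurs twice, once for each edge from v that avoids
    it, and cancels; the corrections add up to an odd number, a contradiction
    ([K5_parity]).  By compactness, a fine enough grid on the square has each of
    its cells mapped into one of four open half-planes ([on_side_mesh]), and
    counting crossings on such a grid only involves the signs of coordinates. *)

Definition clique (V : finType) (e : rel V) (K : {set V}) :=
  {in K &, forall x y, x != y -> e x y}.

(** * Winding modulo 2 by signs of coordinates *)

Section Parity.
Variable R : realDomainType.
Implicit Types z w : R * R.

(** The half-line of points (x, 0) with x > 0 is included so that exactly one of
    z and - z is in the upper half, for every nonzero z. *)
Definition upper z := (0 < z.2) || ((z.2 == 0) && (0 < z.1)).

(** Parity of the crossings of the positive x-axis by the step from z to w.  It
    has this meaning when z and w are both on one [side]: if the upper half is
    left or entered, then that side is [Right] or [Left], so that the sign of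
    z.1 tells which of the two half-axes is crossed. *)
Definition ray_cross z w := (upper z (+) upper w) && (0 < z.1).

Inductive side := Right | Left | Above | Below.
Definition on_side (h : side) z : bool :=
  match h with
  | Right => 0 < z.1 | Left => z.1 < 0 | Above => 0 < z.2 | Below => z.2 < 0
  end.

Lemma on_some_side z : z != 0 -> exists h, on_side h z.
Proof.
case: z => x y /=; rewrite xpair_eqE negb_and.
case: (ltgtP x 0) => [x0|x0|->] /=; [by exists Left|by exists Right|].
by case: (ltgtP y 0) => // y0 _; [exists Below|exists Above].
Qed.

Lemma upperN z : z != 0 -> upper (- z) = ~~ upper z.
Proof.
case: z => x y; rewrite /upper /= xpair_eqE !oppr_gt0 oppr_eq0.
by case: (ltgtP y 0) => //= _; case: (ltgtP x 0).
Qed.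

Lemma on_side_neq0 h z : on_side h z -> z != 0.
Proof. by apply: contraTneq => ->; case: h => /=; rewrite ltxx. Qed.

Lemma ray_cross_side h z w : on_side h z -> on_side h w ->
  ray_cross z w = if h is Right then upper z (+) upper w else false.
Proof.
rewrite /ray_cross; case: h => /= hz hw.
- by rewrite hz andbT.
- by rewrite ltNge ltW // andbF.
- by rewrite /upper hz hw.
- by rewrite /upper !(lt_gtF hz) !(lt_gtF hw) (lt_eqF hz) (lt_eqF hw).
Qed.

(** Reversing both vectors turns a crossing of the positive half-axis into one
    of the negative half-axis, and a step that changes halves crosses exactly
    one of them. *)
Lemma ray_crossN h z w : on_side h z -> on_side h w ->
  ray_cross (- z) (- w) = ray_cross z w (+) (upper z (+) upper w).
Proof.
move=> hz hw; rewrite (ray_cross_side hz hw) /ray_cross.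
rewrite !upperN ?(on_side_neq0 hz) ?(on_side_neq0 hw) // oppr_gt0.
case: h hz hw => /= hz hw.
- by rewrite ltNge ltW //=; case: (upper z); case: (upper w).
- by rewrite hz; case: (upper z); case: (upper w).
- by rewrite /upper hz hw.
- by rewrite /upper !(lt_gtF hz) !(lt_gtF hw) (lt_eqF hz) (lt_eqF hw).
Qed.

(** The winding number around a grid cell vanishes: within one half-plane,
    [ray_cross] is either identically zero or the coboundary of [upper]. *)
Lemma ray_cross_cell h z00 z10 z01 z11 :
  on_side h z00 -> on_side h z10 -> on_side h z01 -> on_side h z11 ->
  ray_cross z00 z10 (+) ray_cross z01 z11 =
  ray_cross z00 z01 (+) ray_cross z10 z11.
Proof.
move=> h00 h10 h01 h11; rewrite !(@ray_cross_side h) //.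
by case: h {h00 h10 h01 h11} => //; case: (upper z00); case: (upper z10);
  case: (upper z01); case: (upper z11).
Qed.

End Parity.

(** * Sampling a pair of disjoint arcs *)

Lemma addb_telescope n (a : nat -> bool) :
  \big[addb/false]_(i < n) (a i (+) a i.+1) = a 0 (+) a n.
Proof.
elim: n => [|n IH]; first by rewrite big_ord0 addbb.
by rewrite big_ord_recr /= IH addbA addbK.
Qed.

(** Stokes' formula modulo 2 on a rectangular grid, for a 1-cochain with values
    h on horizontal edges and v on vertical edges. *)
Lemma grid_boundary n m (h v : nat -> nat -> bool) :
  (forall i j, (i < n)%N -> (j < m)%N ->
     h i j (+) h i j.+1 = v i j (+) v i.+1 j) ->
  \big[addb/false]_(i < n) h i 0 (+) \big[addb/false]_(i < n) h i m =
  \big[addb/false]_(j < m) v 0 j (+) \big[addb/false]_(j < m) v n j.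
Proof.
move=> cell; rewrite -!big_split /=.
transitivity (\big[addb/false]_(i < n) \big[addb/false]_(j < m)
   (v i j (+) v i.+1 j)).
  apply: eq_bigr => i _; rewrite -(addb_telescope m (h i)).
  by apply: eq_bigr => j _; exact: cell.
rewrite exchange_big; apply: eq_bigr => j _ /=.
exact: (addb_telescope n (fun i => v i j)).
Qed.

Section Curves.
Local Open Scope classical_set_scope.
Local Open Scope ring_scope.
Variable R : realType.
Implicit Types (f g : R -> R * R) (p : R * R).

Definition sample f n i := f (i%:R / n.+1%:R).
Definition crossings f n p : bool :=
  \big[addb/false]_(i < n.+1)
    ray_cross (sample f n i - p) (sample f n i.+1 - p).

Lemma sample0 f n : sample f n 0 = f 0.
Proof. by rewrite /sample mul0r. Qed.

Lemma sample1 f n : sample f n n.+1 = f 1.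
Proof. by rewrite /sample divff. Qed.

Lemma on_side_open (h : side) : open [set z : R * R | on_side h z].
Proof.
have fst_cont : continuous (fst : R * R -> R) by move=> z; exact: cvg_fst.
have snd_cont : continuous (snd : R * R -> R) by move=> z; exact: cvg_snd.
case: h.
- rewrite -[X in open X]/(fst @^-1` [set x : R | 0 < x]).
  by apply: open_comp (@open_gt R 0) => z _; exact: fst_cont.
- rewrite -[X in open X]/(fst @^-1` [set x : R | x < 0]).
  by apply: open_comp (@open_lt R 0) => z _; exact: fst_cont.
- rewrite -[X in open X]/(snd @^-1` [set x : R | 0 < x]).
  by apply: open_comp (@open_gt R 0) => z _; exact: snd_cont.
- rewrite -[X in open X]/(snd @^-1` [set x : R | x < 0]).
  by apply: open_comp (@open_lt R 0) => z _; exact: snd_cont.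
Qed.

Lemma on_side_locally f g (s t : R) h :
  {within `[0, 1], continuous f} -> {within `[0, 1], continuous g} ->
  s \in `[0, 1] -> t \in `[0, 1] -> on_side h (f s - g t) ->
  exists2 d : R, 0 < d & forall s' t', s' \in `[0, 1] -> t' \in `[0, 1] ->
    `|s - s'| < d -> `|t - t'| < d -> on_side h (f s' - g t').
Proof.
move=> /subspace_continuousP cf /subspace_continuousP cg s01 t01 hst.
have cfg : f st.1 - g st.2 @[st --> filter_prod (within `[0, 1] (nbhs s))
    (within `[0, 1] (nbhs t))] --> f s - g t.
  by apply: cvgB; [apply: cvg_comp (cf s s01); exact: cvg_fst|
                   apply: cvg_comp (cg t t01); exact: cvg_snd].
have /cfg[[P Q] /= [+ +] PQ] : nbhs (f s - g t) [set z : R * R | on_side h z].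
  by apply: open_nbhs_nbhs; split => //; exact: on_side_open.
rewrite /within /= => /nbhs_ballP[d1 d10 dP] /nbhs_ballP[d2 d20 dQ].
exists (Num.min d1 d2) => [|s' t' s01' t01']; first by rewrite lt_min d10.
rewrite !lt_min => /andP[s1 _] /andP[_ t2].
by apply: (PQ (s', t')); split; [exact: dP|exact: dQ].
Qed.

(** Locally this is continuity, as f s - g t is nonzero and hence on some side;
    compactness of the square makes the mesh uniform.  The radius is two mesh
    steps, so that with strict inequalities it covers the neighbouring grid
    points. *)
Lemma on_side_mesh f g :
  {within `[0, 1], continuous f} -> {within `[0, 1], continuous g} ->
  {in `[0, 1] &, forall s t, f s <> g t} ->
  \forall n \near \oo, forall s t, s \in `[0, 1] -> t \in `[0, 1] ->
    exists h, forall s' t', s' \in `[0, 1] -> t' \in `[0, 1] ->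
    `|s - s'| < 2 * n.+1%:R^-1 -> `|t - t'| < 2 * n.+1%:R^-1 ->
    on_side h (f s' - g t').
Proof.
move=> cf cg fg.
pose P n (st : R * R) := exists h, forall s' t', s' \in `[0, 1] ->
  t' \in `[0, 1] -> `|st.1 - s'| < 2 * n.+1%:R^-1 ->
  `|st.2 - t'| < 2 * n.+1%:R^-1 -> on_side h (f s' - g t').
suff: \forall n \near \oo, `[0, 1] `*` `[0, 1] `<=` P n.
  by apply: filterS => n nP s t s01 t01; exact: (nP (s, t)).
have : compact (`[0, 1] `*` `[0, 1] : set (R * R)).
  by apply: compact_setX; exact: segment_compact.
move=> /compact_near_coveringP; apply => -[s t] [/= s01 t01].
have [h hst] : exists h, on_side h (f s - g t).
  by apply: on_some_side; rewrite subr_eq0; apply/eqP; exact: fg.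
have [d d0 dP] := on_side_locally cf cg s01 t01 hst.
have d20 : 0 < d / 2 by rewrite divr_gt0.
have d40 : 0 < d / 4 by rewrite divr_gt0.
exists (ball (s, t) (d / 2), [set n | n.+1%:R^-1 < d / 4]) => /=.
  by split; [exact: nbhsx_ballx|exact: (near_infty_natSinv_lt (PosNum d40))].
move=> [[s1 t1] n] /= [[/= bs bt] nd]; exists h => s' t' s01' t01' /= ss tt.
rewrite /ball /= in bs bt.
have nd2 : 2 * n.+1%:R^-1 < d / 2.
  by move: nd; move: (n.+1%:R^-1 : R) => x; lra.
by apply: dP => //; [rewrite -(subrKA s1)|rewrite -(subrKA t1)];
  rewrite [ltRHS]splitr (le_lt_trans (ler_normD _ _)) // ltrD //
    (lt_trans _ nd2).
Qed.

(** The winding number of f s - g t along the boundary of the unit square is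
    even.  The right-hand side accounts for the sides s = 0 and s = 1, where
    f s - g t is the opposite of the vector from f s to g t that [crossings]
    follows. *)
Lemma crossings_square f g :
  {within `[0, 1], continuous f} -> {within `[0, 1], continuous g} ->
  {in `[0, 1] &, forall s t, f s <> g t} ->
  \forall n \near \oo,
    crossings f n (g 0) (+) crossings f n (g 1) (+)
    (crossings g n (f 0) (+) crossings g n (f 1)) =
    upper (g 0 - f 0) (+) upper (g 1 - f 0) (+)
    (upper (g 0 - f 1) (+) upper (g 1 - f 1)).
Proof.
move=> cf cg fg; apply: filterS (on_side_mesh cf cg fg) => n sideP.
pose G i j := sample f n i - sample g n j.
have n0 : (0 : R) < n.+1%:R^-1 by rewrite invr_gt0 ltr0n.
have in01 i : (i <= n.+1)%N -> (i%:R / n.+1%:R : R) \in `[0, 1].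
  move=> ile; rewrite in_itv /= divr_ge0 ?ler0n //=.
  by rewrite ler_pdivrMr ?ltr0n // mul1r ler_nat.
have near0 i : `|i%:R / n.+1%:R - i%:R / n.+1%:R : R| < 2 * n.+1%:R^-1.
  by rewrite subrr normr0 mulr_gt0.
have near1 i : `|i%:R / n.+1%:R - i.+1%:R / n.+1%:R : R| < 2 * n.+1%:R^-1.
  rewrite distrC -mulrBl -natrB // subSnn mul1r gtr0_norm //.
  by rewrite ltr_pMl // ltr1n.
have sideG i j : (i <= n.+1)%N -> (j <= n.+1)%N -> exists h, forall i' j',
    (i <= i' <= i.+1)%N -> (j <= j' <= j.+1)%N ->
    (i' <= n.+1)%N -> (j' <= n.+1)%N -> on_side h (G i' j').
  move=> ilt jlt.
  have [h hP] := sideP _ _ (in01 i ilt) (in01 j jlt).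
  have near01 k k' : (k <= k' <= k.+1)%N ->
      `|k%:R / n.+1%:R - k'%:R / n.+1%:R : R| < 2 * n.+1%:R^-1.
    move=> /andP[kk]; rewrite leq_eqVlt ltnS => /predU1P[-> //|k'k].
    by have -> : k' = k by apply/eqP; rewrite eqn_leq k'k.
  by exists h => i' j' ii jj ilt' jlt'; apply: hP; rewrite ?in01 ?near01.
have vertical i : (i <= n.+1)%N ->
    \big[addb/false]_(j < n.+1) ray_cross (G i j) (G i j.+1) =
    crossings g n (sample f n i) (+)
    (upper (g 0 - sample f n i) (+) upper (g 1 - sample f n i)).
  move=> ile; rewrite -(sample0 g n) -(sample1 g n).
  rewrite -(addb_telescope n.+1 (fun j => upper (sample g n j - sample f n i))).
  rewrite -big_split; apply: eq_bigr => j _ /=.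
  have [h hP] := sideG i j ile (ltnW (ltn_ord j)).
  have h0 : on_side h (G i j) by apply: hP; rewrite ?leqnn ?leqnSn // ltnW.
  have h1 : on_side h (G i j.+1) by apply: hP; rewrite ?leqnn ?leqnSn.
  rewrite -!(opprB (sample f n i)) (ray_crossN h0 h1).
  rewrite !upperN ?(on_side_neq0 h0) ?(on_side_neq0 h1) //.
  by case: (ray_cross _ _); do 2![case: (upper _)].
have := @grid_boundary n.+1 n.+1 (fun i j => ray_cross (G i j) (G i.+1 j))
  (fun i j => ray_cross (G i j) (G i j.+1)).
have cellG i j : (i < n.+1)%N -> (j < n.+1)%N ->
    ray_cross (G i j) (G i.+1 j) (+) ray_cross (G i j.+1) (G i.+1 j.+1) =
    ray_cross (G i j) (G i j.+1) (+) ray_cross (G i.+1 j) (G i.+1 j.+1).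
  move=> ilt jlt; have [h hP] := sideG i j (ltnW ilt) (ltnW jlt).
  by apply: (@ray_cross_cell _ h); apply: hP; rewrite ?leqnn ?leqnSn // ltnW.
move=> /(_ cellG); rewrite !vertical // sample0 sample1 /G sample0 sample1.
rewrite /crossings => ->; rewrite -!/(crossings _ _ _).
move: (crossings g n (f 0)) (crossings g n (f 1)) => a b.
move: (upper (g 0 - f 0)) (upper (g 1 - f 0)) => c d.
move: (upper (g 0 - f 1)) (upper (g 1 - f 1)) => c' d'.
by case: a; case: b; case: c; case: d; case: c'; case: d'.
Qed.

End Curves.


(** * Cliques in a planar graph *)

Definition disjoint_edge_pairs : seq (nat * nat * (nat * nat)) :=
  [:: (0, 1, (2, 3)); (0, 2, (1, 3)); (0, 3, (1, 2));
      (0, 1, (2, 4)); (0, 2, (1, 4)); (0, 4, (1, 2));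
      (0, 1, (3, 4)); (0, 3, (1, 4)); (0, 4, (1, 3));
      (0, 2, (3, 4)); (0, 3, (2, 4)); (0, 4, (2, 3));
      (1, 2, (3, 4)); (1, 3, (2, 4)); (1, 4, (2, 3))]%N.

(** Add the 15 equations.  Each [n a b c] occurs twice.  For a < c, the two
    terms [u a c] and [u c a] together occur six times, so that u drops out
    except for one unit for each occurrence in reverse order.  Each of the five
    sets of four vertices contributes 0 + 1 + 2 of these units through its three
    perfect matchings; the total 15 is odd. *)
Lemma K5_parity (n : nat -> nat -> nat -> bool) (u : nat -> nat -> bool) :
  (forall a c, (a < c < 5)%N -> u c a = ~~ u a c) ->
  ~ (forall a b c d, (a, b, (c, d)) \in disjoint_edge_pairs ->
      n a b c (+) n a b d (+) (n c d a (+) n c d b) =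
      u a c (+) u a d (+) (u b c (+) u b d)).
Proof.
move=> uN E.
pose defect (q : nat * nat * (nat * nat)) := let: (a, b, (c, d)) := q in
  n a b c (+) n a b d (+) (n c d a (+) n c d b) (+)
  (u a c (+) u a d (+) (u b c (+) u b d)).
have no_defect : {in disjoint_edge_pairs, forall q, defect q = false}.
  by move=> [[a b] [c d]] /E; rewrite /defect => ->; rewrite addbb.
have : foldr (fun q => addb (defect q)) false disjoint_edge_pairs = false.
  elim: disjoint_edge_pairs no_defect => //= q s IH no_defect.
  rewrite no_defect ?mem_head // IH // => r rs.
  by apply: no_defect; rewrite inE rs orbT.
suff -> : foldr (fun q => addb (defect q)) false disjoint_edge_pairs = true.
  by [].
have addE a b : a (+) b = xorb a b by case: a; case: b.
rewrite /disjoint_edge_pairs /defect /= !addE.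
rewrite (uN 1 2)%N // (uN 1 3)%N // (uN 2 3)%N // (uN 1 4)%N // (uN 2 4)%N //.
rewrite (uN 3 4)%N //; btauto.
Qed.

Section Drawing.
Local Open Scope classical_set_scope.
Local Open Scope ring_scope.
Variables (R : realType) (V : finType) (e : rel V).

Lemma disjoint_edges_drawn_apart (pos : V -> R * R) (arc : V -> V -> R -> R * R)
    u v x y : plane_drawing e pos arc -> e u v -> e x y ->
  u != x -> u != y -> v != x -> v != y ->
  {in `[0, 1] &, forall s t, arc u v s <> arc x y t}.
Proof.
move=> D uv xy ux uy vx vy s t.
have pos_neq a b : a != b -> pos a <> pos b by move=> /eqP ab /(pos_inj D).
have itv01 (r : R) : r \in `[0, 1] -> [\/ r = 0, r = 1 | r \in `]0, 1[].
  rewrite !in_itv /= => /andP[]; rewrite le_eqVlt => /predU1P[<-|r0].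
    by constructor 1.
  rewrite le_eqVlt => /predU1P[->|r1]; first by constructor 2.
  by constructor 3; rewrite r0.
have uvxy : [set u; v]%SET != [set x; y]%SET.
  apply/eqP => /setP/(_ u); rewrite !inE eqxx /=.
  by rewrite (negbTE ux) (negbTE uy).
move=> /itv01[->|->|si] /itv01[->|->|ti];
  rewrite ?(arc_start D uv) ?(arc_end D uv) ?(arc_start D xy) ?(arc_end D xy);
  try exact: pos_neq.
- by apply/nesym; apply: (arc_avoids_vertices D).
- by apply/nesym; apply: (arc_avoids_vertices D).
- by apply: (arc_avoids_vertices D).
- by apply: (arc_avoids_vertices D).
- exact: (arc_disjoint D uv xy).
Qed.

Lemma planar_clique (K : {set V}) :
  planar R e -> clique e K -> (#|K| <= 4)%N.
Proof.
move=> [pos [arc D]] Ke; rewrite leqNgt; apply/negP => K5.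
have [x0 _] : exists x, x \in K.
  by apply/set0Pn; rewrite -card_gt0; exact: leq_trans K5.
pose v := nth x0 (enum K).
have vK a : (a < 5)%N -> v a \in K.
  by move=> a5; rewrite -mem_enum mem_nth // -cardE (leq_trans a5).
have v_neq a b : (a < 5)%N -> (b < 5)%N -> a != b -> v a != v b.
  move=> a5 b5 ab; rewrite nth_uniq ?enum_uniq // -cardE;
    exact: leq_trans K5.
have ve a b : (a < 5)%N -> (b < 5)%N -> a != b -> e (v a) (v b).
  by move=> a5 b5 ab; rewrite Ke ?vK ?v_neq.
pose n N a b c := crossings (arc (v a) (v b)) N (pos (v c)).
pose u a c := upper (pos (v c) - pos (v a)).
have uN a c : (a < c < 5)%N -> u c a = ~~ u a c.
  move=> /andP[ac c5]; rewrite /u -opprB upperN // subr_eq0.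
  apply/eqP => /(pos_inj D)/eqP; apply/negP/v_neq => //.
    exact: ltn_trans c5.
  by rewrite gtn_eqF.
pose square N (q : nat * nat * (nat * nat)) := let: (a, b, (c, d)) := q in
  n N a b c (+) n N a b d (+) (n N c d a (+) n N c d b) =
      u a c (+) u a d (+) (u b c (+) u b d).
(* A single sampling size has to serve all pairs of edges, since the turns of
   one edge are compared between different pairs. *)
have : \forall N \near \oo, forall q : seq_sub disjoint_edge_pairs,
    square N (ssval q).
  apply: filter_forall => -[[[a b] [c d]] /= q].
  have /and5P[/and4P[a5 b5 c5 d5] /andP[ab cd] /andP[ac ad] bc bd] :
      [&& [&& a < 5, b < 5, c < 5 & d < 5], (a != b) && (c != d),
        (a != c) && (a != d), b != c & b != d]%N.
    by apply: (allP (_ : all (fun q : nat * nat * (nat * nat) =>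
      let: (a, b, (c, d)) := q in
      [&& [&& a < 5, b < 5, c < 5 & d < 5], (a != b) && (c != d),
        (a != c) && (a != d), b != c & b != d]%N) disjoint_edge_pairs) _ q).
  have eab := ve a b a5 b5 ab; have ecd := ve c d c5 d5 cd.
  rewrite /n /u -(arc_start D eab) -(arc_end D eab) -(arc_start D ecd)
    -(arc_end D ecd).
  apply: crossings_square; [exact: (arc_continuous D)..|].
  by apply: (disjoint_edges_drawn_apart D) => //; exact: v_neq.
move=> /filter_ex[N squareN]; apply: (@K5_parity (n N) u uN) => a b c d q.
exact: (squareN (SeqSub q)).
Qed.

End Drawing.

(** * Vertices complete to a clique in a chordal graph *)

Section ChordalCovers.
Import mathcomp.boot.fintype mathcomp.boot.finset.
Local Open Scope nat_scope.

Lemma next_nthS (T : eqType) (x0 : T) c i : uniq c -> i.+1 < size c ->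
  next c (nth x0 c i) = nth x0 c i.+1.
Proof.
move=> c_uniq ilt; have ilt' := ltnW ilt.
rewrite next_nth mem_nth // index_uniq //.
by case: c {c_uniq ilt'} ilt => //= y s ilt; apply: set_nth_default.
Qed.

Lemma next_nth_last (T : eqType) (x0 : T) c : uniq c ->
  next c (nth x0 c (size c).-1) = nth x0 c 0.
Proof.
case: c => [|y s] // c_uniq; rewrite next_nth mem_nth // index_uniq //.
by rewrite nth_default.
Qed.

Lemma last_take (T : Type) (x : T) s i : i <= size s ->
  last x (take i s) = nth x (x :: s) i.
Proof.
case: i => [|i] ile; first by rewrite take0.
by rewrite (last_nth x) size_takel //= nth_take.
Qed.

Section Definitions.
Variables (V : finType) (e : rel V).

Definition induced (D : {set V}) : rel V :=
  [rel x y | [&& e x y, x \in D & y \in D]].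

Definition connected_in (D : {set V}) :=
  {in D &, forall x y, connect (induced D) x y}.

Definition path_free k (S : {set V}) := forall p : seq V,
  uniq p -> sorted e p -> size p = k -> ~ {subset p <= S}.

(** C is a union of components of the graph that S - K induces. *)
Definition cut_off (S K C : {set V}) :=
  [/\ K \subset S, C \subset S, [disjoint K & C]
    & forall x y, x \in C -> y \in S -> e x y -> y \in C :|: K].

End Definitions.

Section Chordal.
Variables (V : finType) (e : rel V).
Hypotheses (e_sym : symmetric e) (e_irr : irreflexive e) (e_ch : chordal e).
Implicit Types S K C D T : {set V}.

(** A cycle of length at least four whose only edges join cyclically consecutive
    positions would be induced.  The excluded pair (0, size c - 1) is the edge
    that closes the cycle. *)
Lemma chordal_chord x0 (c : seq V) : uniq c -> cycle e c -> 3 < size c ->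
  exists i j, [/\ i.+1 < j < size c, ~~ ((i == 0) && (j == (size c).-1))
               & e (nth x0 c i) (nth x0 c j)].
Proof.
move=> c_uniq c_cyc c_size; apply: contrapT => nochord.
suff cind : induced_cycle e c by exact: (e_ch cind).
split; [exact: ltnW|exact: c_uniq|].
move=> x y xc yc; apply/idP/idP; last first.
  by case/orP => /eqP <-; [|rewrite e_sym]; apply: (next_cycle c_cyc).
rewrite -(nth_index x0 xc) -(nth_index x0 yc).
move: (index x c) (index y c) (index_mem x c) (index_mem y c) => i j.
rewrite {}xc {}yc.
wlog ij : i j / i < j => [wlog_ij|] ilt jlt eij.
  case: (ltngtP i j) => [ij|ji|E]; [exact: wlog_ij| |by rewrite E e_irr in eij].
  by rewrite orbC; apply: wlog_ij => //; rewrite e_sym.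
have [E|iSj] := eqVneq i.+1 j.
  by subst j; rewrite next_nthS // eqxx.
have [/andP[/eqP-> /eqP->]|nends] := boolP ((i == 0) && (j == (size c).-1)).
  by rewrite (next_nth_last x0) // eqxx orbT.
by case: nochord; exists i, j; split=> //; rewrite jlt ltn_neqAle iSj ij.
Qed.

(** Take such a path of minimal length: a chord, a repeated vertex, or an
    earlier vertex satisfying P would give a shorter one. *)
Lemma shortest_path (D : {set V}) (P : pred V) d p :
  path e d p -> {subset d :: p <= D} -> P (last d p) ->
  exists q, [/\ path e d q, {subset d :: q <= D}, P (last d q), uniq (d :: q) &
    (forall i, i < size q -> ~~ P (nth d (d :: q) i)) /\
    (forall i j, i.+1 < j <= size q ->
       ~~ e (nth d (d :: q) i) (nth d (d :: q) j))].
Proof.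
pose good q := [&& path e d q, all (mem D) (d :: q) & P (last d q)].
move=> dp pD pP.
have ex_good : exists m, [exists q : m.-tuple V, good q].
  exists (size p); apply/existsP; exists (in_tuple p).
  by rewrite /good dp pP andbT; apply/allP.
case: (ex_minnP ex_good) => m /existsP[q qgood] qmin.
have {}qmin r : good r -> size q <= size r.
  move=> rgood; rewrite size_tuple; apply: qmin.
  by apply/existsP; exists (in_tuple r).
move: (tval q) qgood qmin => {m}q /and3P[dq /allP qD qP] qmin; exists q.
split=> //.
  case/shortenP: dq qP qmin qD => q' dq' q'_uniq q'q qP qmin qD.
  have q'_sub : {subset d :: q' <= d :: q}.
    by move=> z; rewrite !inE => /predU1P[->|/q'q->]; rewrite ?eqxx ?orbT.
  apply: (leq_size_uniq q'_uniq q'_sub).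
  apply: qmin; rewrite /good dq' qP andbT; apply/allP => z /q'_sub.
  exact: qD.
split=> [i iq|i j /andP[ij jq]].
- apply/negP => Pi; suff /qmin : good (take i q).
    by rewrite size_takel ?(ltnW iq) // leqNgt iq.
  rewrite /good take_path // last_take ?(ltnW iq) // Pi andbT.
  apply/allP => z; rewrite inE => /predU1P[->|/mem_take zq]; apply: qD.
    exact: mem_head.
  by rewrite inE zq orbT.
- apply/negP => eij.
  have iq : i <= size q by apply: leq_trans jq; do 2!apply: ltnW.
  have : path e d (take j q ++ drop j q) by rewrite cat_take_drop.
  rewrite cat_path last_take // => /andP[_ jpath].
  have lastE : last (nth d (d :: q) j) (drop j q) = last d q.
    by rewrite -[in RHS](cat_take_drop j q) last_cat last_take.
  pose r := take i q ++ nth d (d :: q) j :: drop j q.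
  suff /qmin : good r.
    by rewrite size_cat /= size_takel // size_drop => ?; lia.
  apply/and3P; split.
  - by rewrite cat_path take_path // last_take //= eij.
  - apply/allP => z; rewrite inE mem_cat inE => zr; apply: qD.
    case/or4P: zr => [/eqP->|/mem_take zq|/eqP->|/mem_drop zq].
    + exact: mem_head.
    + by rewrite inE zq orbT.
    + by rewrite mem_nth.
    + by rewrite inE zq orbT.
  - by rewrite last_cat /= lastE.
Qed.

Lemma induced_path (D : {set V}) x p : x \in D -> path (induced e D) x p ->
  path e x p /\ {subset x :: p <= D}.
Proof.
elim: p x => [|y p IH] x xD /=.
  by move=> _; split => // z /[1!inE] /eqP->.
case/andP=> /and3P[exy _ yD] /(IH y yD)[yp ypD]; rewrite exy; split=> // z.
by rewrite inE => /predU1P[->|/ypD].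
Qed.

(** The edge x y, the part of the path from the last neighbour s_i of y to the
    end, and the edge from that end back to x form a cycle without chords.  It
    has at least four vertices unless s_i is the end of the path. *)
Lemma chordal_path_end_adjacent (D : {set V}) x y q d :
  x \notin D -> y \notin D -> x != y -> e x y ->
  path e d q -> {subset d :: q <= D} -> uniq (d :: q) ->
  (forall i, i < size q -> ~~ e x (nth d (d :: q) i)) ->
  (forall i j, i.+1 < j <= size q ->
     ~~ e (nth d (d :: q) i) (nth d (d :: q) j)) ->
  e x (last d q) -> e y d -> e y (last d q).
Proof.
move=> xD yD xy exy dq qD q_uniq xq q_ind xl yd; apply/negPn/negP => yl.
have exi : exists i, (i <= size q) && e y (nth d (d :: q) i) by exists 0.
have ubi i : (i <= size q) && e y (nth d (d :: q) i) -> i <= size q.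
  by case/andP.
case: (ex_maxnP exi ubi) => i /andP[iq yi] imax.
have {}iq : i < size q.
  rewrite ltn_neqAle iq andbT; apply: contraNneq yl => E.
  by rewrite E -last_take // take_size in yi.
pose c := [:: x, y & drop i (d :: q)].
have c_size : size c = (size q - i).+3.
  by rewrite /= size_drop /= subSn // ltnW.
have nth_c k : nth d c k.+2 = nth d (d :: q) (i + k) by rewrite /= nth_drop.
have drop_i : drop i (d :: q) = nth d (d :: q) i :: drop i q.
  by rewrite (drop_nth d) //= ltnW.
have c_uniq : uniq c.
  rewrite /= drop_uniq // inE negb_or xy /= andbT.
  by apply/andP; split; [move: xD|move: yD]; apply: contra => /mem_drop/qD.
have c_cyc : cycle e c.
  have : path e d (take i q ++ drop i q) by rewrite cat_take_drop.
  rewrite cat_path last_take ?(ltnW iq) // => /andP[_ ipath].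
  rewrite /c drop_i /= exy yi rcons_path ipath /= e_sym.
  suff -> : last (nth d (d :: q) i) (drop i q) = last d q by [].
  by rewrite -[in RHS](cat_take_drop i q) last_cat last_take // ltnW.
have [|a [b [/andP[ab bc]]]] := chordal_chord d c_uniq c_cyc.
  by rewrite c_size; clear -iq; lia.
rewrite c_size in bc *; case: b ab bc => [|[|b]] // ab bc.
case: a ab => [|[|a]] ab; rewrite !nth_c.
(* The three cases are a chord at x, a chord at y, and a chord of the path. *)
- move=> bend; apply/negP/xq; rewrite /= !eqSS in bend.
  by clear -bend bc iq; lia.
- move=> _ yb; have := imax (i + b); rewrite yb andbT.
  by clear -ab bc iq; lia.
- by move=> _; apply/negP/q_ind; clear -ab bc iq; lia.
Qed.

(** Take d in D with as many neighbours in K as possible.  If x in K is not one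
    of them, then the end of a shortest path in D from d to a neighbour of x is
    adjacent to x and, by chordality, to all neighbours of d in K. *)
Lemma complete_vertex (K D : {set V}) : clique e K -> connected_in e D ->
  [disjoint K & D] -> D != set0 ->
  {in K, forall x, exists2 d, d \in D & e x d} ->
  exists2 d, d \in D & {in K, forall x, e x d}.
Proof.
move=> Kcl Dcon KD /set0Pn[d0 d0D] Knbr.
pose nbr d := [set x in K | e x d].
case: (arg_maxnP (fun d => #|nbr d|) d0D) => d dD dmax; exists d => // x xK.
apply/negPn/negP => nxd.
have [l lD xl] := Knbr x xK.
have /connectP[p dp lE] := Dcon d l dD lD.
have [{}dp pD] := induced_path dD dp; rewrite lE in xl.
have [q [dq qD xq q_uniq [xmin q_ind]]] := shortest_path dp pD xl.
suff : #|nbr d| < #|nbr (last d q)|.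
  by rewrite ltnNge => /negP; apply; apply: dmax; apply: qD; exact: mem_last.
have notD z : z \in K -> z \notin D by move=> zK; rewrite (disjointFr KD zK).
apply/proper_card/properP; split.
  apply/subsetP => y; rewrite !inE => /andP[yK yd]; rewrite yK /=.
  have xy : x != y by apply: contraNneq nxd => ->.
  exact: (chordal_path_end_adjacent (notD x xK) (notD y yK) xy
    (Kcl x y xK yK xy) dq qD q_uniq xmin q_ind xq yd).
by exists x; rewrite !inE xK.
Qed.

(** * Cutting off path-free pieces by cliques *)

Lemma cut_off_path S K C h q : cut_off e S K C -> path e h q ->
  {subset h :: q <= S :\: K} -> {in q, forall z, (z \in C) = (h \in C)}.
Proof.
case=> _ _ _ closed; elim: q h => //= y q IH h /andP[hy yq] qS.
have yS : {subset y :: q <= S :\: K}.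
  by move=> z zq; apply: qS; rewrite inE zq orbT.
have hC : (y \in C) = (h \in C).
  have /setDP[hS hK] := qS h (mem_head _ _).
  have /setDP[yS' yK] := yS y (mem_head _ _).
  apply/idP/idP => [yC|hC].
    have := closed y h yC hS; rewrite e_sym hy inE (negbTE hK) orbF; exact.
  by have := closed h y hC yS' hy; rewrite inE (negbTE yK) orbF.
by move=> z; rewrite inE => /predU1P[->|/(IH y yq yS)->].
Qed.

Lemma induced_sym D : symmetric (induced e D).
Proof. by move=> x y; rewrite /induced /= e_sym [(x \in D) && _]andbC. Qed.

Lemma component_connected (C : {set V}) h :
  connected_in e [set y | connect (induced e C) h y].
Proof.
set D := [set y | _] => x y xD yD.
have Csym := sym_connect_sym (induced_sym C).
have : connect (induced e C) x y.
  by move: xD yD; rewrite !inE Csym => xh; exact: connect_trans.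
case/connectP => p xp ->; apply/connectP; exists p => //.
elim: p x xD xp => //= z p IH x xD /andP[xz zp].
have zD : z \in D.
  by move: xD; rewrite !inE => hx; apply: connect_trans hx (connect1 xz).
by rewrite {1}/induced /= xD zD (IH z) // andbT; case/and3P: xz => ->.
Qed.

(** D is the component of a long path in C, K' the set of its neighbours in K,
    and the new pair is (K' + d, D - d) for a vertex d of D complete to K'.  The
    long path ensures that D - d still has k vertices. *)
Lemma cut_off_smaller k S K C : clique e K -> cut_off e S K C ->
  ~ path_free e k.+1 C -> exists K' C',
  [/\ clique e K', cut_off e S K' C', k <= #|C'| & #|C'| < #|C|].
Proof.
move=> Kcl [KS CS KC closed] notfree.
have [p [p_uniq p_path p_size pC]] : exists p : seq V,
    [/\ uniq p, sorted e p, size p = k.+1 & {subset p <= C}].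
  apply: contrapT => nop; apply: notfree => p p1 p2 p3 p4.
  by apply: nop; exists p.
case: p p_size p_uniq p_path pC => // h p [p_size] p_uniq hp pC.
have hC : h \in C by apply: pC; exact: mem_head.
pose D := [set y | connect (induced e C) h y].
have hD : h \in D by rewrite inE connect0.
have DC : D \subset C.
  apply/subsetP => y; rewrite inE => /connectP[q hq ->].
  by have [_] := induced_path hC hq; apply; exact: mem_last.
have stepD x y : x \in D -> y \in C -> e x y -> y \in D.
  move=> xD yC xy; have xC := subsetP DC x xD.
  move: xD; rewrite !inE => /connect_trans; apply.
  by rewrite connect1 // /induced /= xy xC.
have pD : {subset h :: p <= D}.
  suff pathD q x : x \in D -> path e x q -> {subset q <= C} ->
      {subset x :: q <= D}.
    by apply: pathD => // z zp; apply: pC; rewrite inE zp orbT.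
  elim: q x => [|y q IH] x xD /=; first by move=> _ _ z /[1!inE] /eqP->.
  move=> /andP[xy yq] qC z; rewrite inE => /predU1P[->//|]; apply: IH => //.
    by apply: stepD xy => //; apply: qC; exact: mem_head.
  by move=> w wq; apply: qC; rewrite inE wq orbT.
have Dk : k < #|D|.
  rewrite -p_size -[(size p).+1]/(size (h :: p)) -(card_uniqP p_uniq).
  by apply: subset_leq_card; apply/subsetP.
pose K' := [set x in K | [exists d in D, e x d]].
have K'K : K' \subset K by apply/subsetP => x; rewrite inE => /andP[].
have [|||||d dD Kd] := @complete_vertex K' D.
- by move=> x y /(subsetP K'K) xK /(subsetP K'K) yK; exact: Kcl.
- exact: component_connected.
- exact: disjointWl K'K (disjointWr DC KC).
- by apply/set0Pn; exists h.
- by move=> x; rewrite inE => /andP[_ /exists_inP[d dD xd]]; exists d.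
have CK x : x \in C -> x \notin K by move=> xC; rewrite (disjointFl KC xC).
exists (d |: K'), (D :\ d); split.
- move=> x y; rewrite !in_setU1 => /predU1P[->|xK] /predU1P[->|yK] xy.
  + by rewrite eqxx in xy.
  + by rewrite e_sym Kd.
  + by rewrite Kd.
  + by apply: Kcl xy; apply: (subsetP K'K).
- split.
  + rewrite subUset sub1set (subsetP CS) ?(subsetP DC) //.
    exact: subset_trans KS.
  + by apply: subset_trans (subD1set _ _) (subset_trans DC CS).
  + rewrite disjoint_sym disjoint_subset; apply/subsetP => x; rewrite !inE.
    case/andP => xd xD; rewrite negb_or xd negb_and.
    by rewrite CK // (subsetP DC) // inE.
  + move=> x y /setD1P[_ xD] yS xy.
    have := closed x y (subsetP DC x xD) yS xy.
    rewrite !in_setU in_setD1 in_set1; case: (y =P d) => //= _ /orP[yC|yK].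
      by rewrite (stepD x y xD yC xy).
    suff -> : y \in K' by rewrite orbT.
    by rewrite inE yK; apply/exists_inP; exists x; rewrite // e_sym.
- by rewrite -ltnS (leq_trans Dk) // (cardsD1 d D) dD.
- by rewrite (leq_trans _ (subset_leq_card DC)) // (cardsD1 d D) dD.
Qed.

(** Descend by [cut_off_smaller], starting from the empty clique, which cuts off
    all of S. *)
Lemma cut_off_path_free k S : k <= #|S| -> exists K C,
  [/\ clique e K, cut_off e S K C, k <= #|C| & path_free e k.+1 C].
Proof.
move=> kS.
suff cut m K C : #|C| < m -> clique e K -> cut_off e S K C -> k <= #|C| ->
    exists K C,
    [/\ clique e K, cut_off e S K C, k <= #|C| & path_free e k.+1 C].
  apply: (cut #|S|.+1 set0 S) => //; first by move=> x y; rewrite inE.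
  split; rewrite ?sub0set // ?disjoints_subset ?sub0set // => x y _ yS _.
  by rewrite setU0.
elim: m K C => // m IH K C /ltnSE Cm Kcl cutC kC.
have [Cfree|/(cut_off_smaller Kcl cutC)] := pselect (path_free e k.+1 C).
  by exists K, C.
case=> K' [C' [Kcl' cutC' kC' /leq_trans/(_ Cm)C'm]].
exact: IH C'm Kcl' cutC' kC'.
Qed.

(** Each round spends a clique K, of at most w vertices, and keeps a set C of at
    least k vertices that is no longer joined to the rest, so that a path on
    k + 1 vertices avoiding the cover lies in C or in the rest.  When fewer than
    k vertices are left, nothing has to be spent. *)
Lemma path_cover_bound w k S : 0 < k ->
  (forall K : {set V}, clique e K -> #|K| <= w) ->
  exists T : {set V},
    path_free e k.+1 (S :\: T) /\ (w + k) * #|T| <= w * #|S|.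
Proof.
move=> k0 Kw; have [m] := ubnP #|S|; elim: m S => // m IH S /ltnSE Sm.
have [Sk|kS] := ltnP #|S| k.
  exists set0; rewrite setD0 cards0 muln0; split=> // p p_uniq _ p_size pS.
  have /subset_leq_card : [set x in p] \subset S.
    by apply/subsetP => x; rewrite inE => /pS.
  by rewrite cardsE (card_uniqP p_uniq) p_size leqNgt ltnS (ltnW Sk).
have [K [C [Kcl cutC kC Cfree]]] := cut_off_path_free kS.
have [KS CS KC _] := cutC.
have KCS : K :|: C \subset S by rewrite subUset KS.
have cardKC : #|K :|: C| = #|K| + #|C|.
  by rewrite cardsU (disjoint_setI0 KC) cards0 subn0.
have cardS : #|S| = #|K| + #|C| + #|S :\: (K :|: C)|.
  by rewrite -cardKC -(cardsID (K :|: C) S) (setIidPr KCS).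
have [|T [Tfree Tw]] := IH (S :\: (K :|: C)); first by lia.
exists (K :|: T); split.
  case=> [|h p] // p_uniq hp p_size pS.
  have pSK : {subset h :: p <= S :\: K}.
    by move=> z /pS; rewrite !inE negb_or => /andP[/andP[-> _] ->].
  have pC := cut_off_path cutC hp pSK.
  have [hC|hC] := boolP (h \in C).
    apply: (Cfree (h :: p)) => // z; rewrite inE => /predU1P[->//|zp].
    by rewrite pC.
  apply: (Tfree (h :: p)) => // z zp.
  have zC : z \notin C.
    by move: zp; rewrite inE => /predU1P[->//|zp]; rewrite pC.
  have := pS z zp; rewrite !inE !negb_or => /andP[/andP[-> ->] ->].
  by rewrite zC.
have wC : k * #|K| <= w * #|C| by rewrite mulnC leq_mul // Kw.
apply: (leq_trans (leq_mul (leqnn _) (leq_card_setU K T))).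
rewrite cardS mulnDr !mulnDr leq_add // mulnDl; exact: leq_add.
Qed.

Lemma psi_leq (T : {set V}) k :
  path_free e k.+1 (~: T) -> psi e k.+1 <= #|T|.
Proof.
move=> Tfree; rewrite /psi; case: arg_minnP => [|U _].
  apply/existsP => -[p /and3P[_ _ /allP/(_ (thead p))]].
  by rewrite inE => /(_ (mem_tnth _ _)).
apply; apply/existsP => -[p /and3P[p_uniq p_path /allP pT]].
apply: (Tfree p) => //; first by rewrite size_tuple.
by move=> z /pT; rewrite inE.
Qed.

Lemma chordal_psi_bound w k : 0 < k ->
  (forall K : {set V}, clique e K -> #|K| <= w) ->
  (w + k) * psi e k.+1 <= w * #|V|.
Proof.
move=> k0 /(path_cover_bound [set: V] k0)[T []].
rewrite setTD cardsT => /psi_leq psiT; apply: leq_trans.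
by rewrite leq_mul2l psiT orbT.
Qed.

End Chordal.

End ChordalCovers.

(** * The bounds for chordal planar graphs *)

Theorem corollary23 (R : realType) (V : finType) (e : rel V)
    (e_simple : simple_graph e) (e_chordal : chordal e)
    (e_planar : planar R e) :
  [/\ (psi e 3)%:R <= 2 / 3 * #|V|%:R :> rat,
      (psi e 4)%:R <= 4 / 7 * #|V|%:R :> rat
    & (psi e 5)%:R <= 1 / 2 * #|V|%:R :> rat].
Proof.
case: e_simple => e_sym e_irr.
have K4 (K : {set V}) : clique e K -> (#|K| <= 4)%N.
  exact: (planar_clique e_planar).
have bound k : (0 < k)%N ->
    (4 + k%:R) * (psi e k.+1)%:R <= 4 * #|V|%:R :> rat.
  move=> k0; rewrite -natrD -!natrM ler_nat.
  exact: (chordal_psi_bound e_sym e_irr e_chordal k0 K4).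
by split; [move: (bound 2 isT)|move: (bound 3 isT)|move: (bound 4 isT)]; lra.
Qed.
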